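(* Let $p$ be an odd integer, let $j$ and $i$ be integers, and let $k=(p-1)/2+ip$. Then $$ s_k(\mathcal{T}_p(j)) = s_i(\mathcal{T}_p(j))\,\mathcal{P}_{(p-1)/2}\big((2-j)\,s_k(j)^2\big), $$ and in particular $$ s_k(\mathcal{T}_p(j))\equiv p\, s_i(\mathcal{T}_p(j)) \pmod{(j-2)\,s_k(j)^2}. $$
   Context: For a number $n$, the sequence $(s_k(n))_{k\in\mathbb{Z}}$ is defined by $s_0(n)=1$, $s_1(n)=n+1$ and $s_{k+2}(n)=n\,s_{k+1}(n)-s_k(n)$ for all $k\in\mathbb{Z}$; for each $k$, $s_k(n)$ is a polynomial in $n$ with integer coefficients. The polynomials $\mathcal{P}_k\in\mathbb{Z}[z]$ are defined by $\mathcal{P}_k(z)=s_k(2-z)$. The dilated Chebyshev polynomials of the first kind $\mathcal{T}_k$ are defined by $\mathcal{T}_k(2\cos\theta)=2\cos(k\theta)$; equivalently $\mathcal{T}_0(x)=2$, $\mathcal{T}_1(x)=x$, $\mathcal{T}_{k+2}(x)=x\,\mathcal{T}_{k+1}(x)-\mathcal{T}_k(x)$. *)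

(* Defs.v *)
(* MathComp world. *)
From HB Require Import structures.
From mathcomp Require Import all_boot all_order all_algebra.

Set Implicit Arguments.
Unset Strict Implicit.
Unset Printing Implicit Defensive.

Import Order.TTheory GRing.Theory Num.Theory.

Local Open Scope ring_scope.

Fixpoint linrec (R : pzRingType) (x a b : R) (m : nat) : R :=
  if m is m'.+1 then linrec x b (x * b - a) m' else a.

(* The two-sided sequence u with u 0 = a, u 1 = b and
   u (k + 2) = x * u (k + 1) - u k for every k : int. Since the recurrence is
   symmetric under k -> - k, its negative part is the one-sided sequence
   starting from u 0 = a and u (- 1) = x * a - b. *)
Definition linrecz (R : pzRingType) (x a b : R) (k : int) : R :=
  match k with
  | Posz m => linrec x a b m
  | Negz m => linrec x a (x * a - b) m.+1
  end.

Lemma linrecSS (R : pzRingType) (x a b : R) (m : nat) :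
  linrec x a b m.+2 = x * linrec x a b m.+1 - linrec x a b m.
Proof. by elim: m a b => [|m IHm] a b //; rewrite [LHS]/= -IHm. Qed.

Lemma linreczSS (R : pzRingType) (x a b : R) (k : int) :
  linrecz x a b (k + 2) = x * linrecz x a b (k + 1) - linrecz x a b k.
Proof.
case: k => [m|[|[|m]]].
- by rewrite -!PoszD addn2 addn1; apply: linrecSS.
- by rewrite /= subKr.
- by rewrite /= subKr.
have -> : Negz m.+2 + 2 = Negz m by rewrite !NegzE -addn2 PoszD opprD addrK.
have -> : Negz m.+2 + 1 = Negz m.+1.
  by rewrite !NegzE -[m.+3]addn1 PoszD opprD addrK.
by rewrite /linrecz (linrecSS _ _ _ m.+1) subKr.
Qed.

(* s_k, as a polynomial in the variable n. *)
Definition spoly (k : int) : {poly int} := linrecz 'X 1 ('X + 1) k.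

Definition Ppoly (k : int) : {poly int} := spoly k \Po (2%:P - 'X).

(* T_k for every k : int; chebTN shows that T_(-k) = T_k, as required by
   T_k(2 cos t) = 2 cos (k t). *)
Definition chebT (k : int) : {poly int} := linrecz 'X 2%:P 'X k.

Lemma spoly_rec (n : int) :
  [/\ (spoly 0).[n] = 1, (spoly 1).[n] = n + 1
    & forall k : int,
        (spoly (k + 2)).[n] = n * (spoly (k + 1)).[n] - (spoly k).[n]].
Proof.
split=> [||k]; [by rewrite hornerE | by rewrite !hornerE |].
by rewrite /spoly linreczSS !hornerE.
Qed.

Lemma horner_Ppoly (k z : int) : (Ppoly k).[z] = (spoly k).[2 - z].
Proof. by rewrite horner_comp !hornerE. Qed.

Lemma chebT_rec (x : int) :
  [/\ (chebT 0).[x] = 2, (chebT 1).[x] = x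
    & forall k : int,
        (chebT (k + 2)).[x] = x * (chebT (k + 1)).[x] - (chebT k).[x]].
Proof.
split=> [||k]; [by rewrite hornerE | by rewrite !hornerE |].
by rewrite /chebT linreczSS !hornerE.
Qed.

Lemma chebTN (k : int) : chebT (- k) = chebT k.
Proof.
have H : 'X * 2%:P - 'X = 'X :> {poly int}.
  by rewrite -[2]/(1 + 1) polyCD mulrDr mulr1 addrK.
by case: k => [[|m]|m] //; rewrite /chebT -?NegzE ?NegzE ?opprK /linrecz H.
Qed.

(* Main.v *)
(* Write s_k, T_k for the values at x. For any solution u of the recurrence,
   T_p * u_k = u_(k + p) + u_(k - p), so every step-p subsequence of u solves
   the recurrence with parameter T_p. Hence T_k(T_p(x)) = T_(k p)(x) and
   s_k(T_(2m+1)(x)) s_m(x) = s_(m + k(2m+1))(x), while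
   2 + (x - 2) s_k^2 = T_(2k+1). With p = 2m + 1 and 2k + 1 = (2i + 1) p the
   right-hand side of the theorem is s_i(X) s_m(T_(2i+1)(X)) at X = T_p(j),
   which the composition formula turns into s_(i + m(2i+1))(X) = s_k(X). *)
Require Import Defs.
From HB Require Import structures.
From mathcomp Require Import all_boot all_order all_algebra.
From mathcomp Require Import ring zify.

Set Implicit Arguments.
Unset Strict Implicit.
Unset Printing Implicit Defensive.

Import Order.TTheory GRing.Theory Num.Theory.

Local Open Scope ring_scope.

Definition linrec_sol (R : pzRingType) (x : R) (u : int -> R) :=
  forall k, u (k + 2) = x * u (k + 1) - u k.

(** The coefficient of [u k] in the recurrence is -1, so a backward step needs only additive
    cancellation, and the induction runs both ways over any ring. *)
Lemma linrec_sol_unique (R : pzRingType) (x : R) (u v : int -> R) :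
  linrec_sol x u -> linrec_sol x v -> u 0 = v 0 -> u 1 = v 1 -> u =1 v.
Proof.
move=> hu hv h0 h1 k; suff: u k = v k /\ u (k + 1) = v (k + 1) by case.
elim/int_rec: k => [|n [e1 e2]|n [e1 e2]] //.
- rewrite -addn1 PoszD; split=> //.
  by rewrite -addrA -[1 + 1 : int]/2 hu hv e1 e2.
set k := - (n.+1%:Z); have ek : - n%:Z = k + 1 by rewrite /k; lia.
move: e1 e2; rewrite ek -addrA -[1 + 1 : int]/2 => e1 e2; split=> //.
by move: e2; rewrite hu hv e1 => /addrI /oppr_inj.
Qed.

Lemma horner_linrecz (R : comNzRingType) (a b : {poly R}) (x : R) (k : int) :
  (linrecz 'X a b k).[x] = linrecz x a.[x] b.[x] k.
Proof.
have H m c d : (linrec 'X c d m).[x] = linrec x c.[x] d.[x] m.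
  by elim: m c d => //= m IH c d; rewrite IH !hornerE.
by case: k => m; rewrite /linrecz H // !hornerE.
Qed.

Section Sequences.

Variables (R : comPzRingType) (x : R).

(** For [x] = w + 1/w this is w^(-k) + ... + w^k when k >= 0, and [tseq k] is w^k + w^(-k). *)
Definition sseq (k : int) : R := linrecz x 1 (x + 1) k.
Definition tseq (k : int) : R := linrecz x 2 x k.

Lemma sseq_sol : linrec_sol x sseq. Proof. exact: linreczSS. Qed.
Lemma tseq_sol : linrec_sol x tseq. Proof. exact: linreczSS. Qed.

(** For fixed [k] both sides solve the recurrence in [p]; at [p] = 1 they agree by the recurrence at
    [k - 1]. *)
Lemma linrec_sol_shift (u : int -> R) (p k : int) :
  linrec_sol x u -> tseq p * u k = u (k + p) + u (k - p).
Proof.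
move=> hu; apply: (@linrec_sol_unique R x (fun q => tseq q * u k)
  (fun q => u (k + q) + u (k - q))) => [q|q||].
- rewrite tseq_sol; ring.
- have := hu (k + q); have := hu (k - (q + 2)).
  rewrite (_ : k - (q + 2) + 2 = k - q); last ring.
  rewrite (_ : k - (q + 2) + 1 = k - (q + 1)); last ring.
  by rewrite -!addrA => -> ->; ring.
- by rewrite /= ?oppr0 !addr0 /tseq /=; ring.
have := hu (k - 1); rewrite (_ : k - 1 + 2 = k + 1); last ring.
by rewrite subrK => ->; rewrite subrK.
Qed.

Lemma linrec_sol_step (u : int -> R) (p a : int) :
  linrec_sol x u -> linrec_sol (tseq p) (fun k => u (a + k * p)).
Proof.
move=> hu k; rewrite linrec_sol_shift //.
rewrite (_ : a + (k + 1) * p + p = a + (k + 2) * p); last ring.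
rewrite (_ : a + (k + 1) * p - p = a + k * p); last ring.
by rewrite addrK.
Qed.

(** The reflection k -> -k - 1 preserves the recurrence, and s_(-1) = -1 fixes the sign. *)
Lemma sseqN (k : int) : sseq (- k - 1) = - sseq k.
Proof.
apply: (@linrec_sol_unique R x (fun k => sseq (- k - 1)) (fun k => - sseq k))
  => [q|q||].
- have := sseq_sol (- (q + 2) - 1).
  rewrite (_ : - (q + 2) - 1 + 2 = - q - 1); last ring.
  rewrite (_ : - (q + 2) - 1 + 1 = - (q + 1) - 1); last ring.
  by move=> ->; ring.
- by rewrite sseq_sol; ring.
- by rewrite /sseq /=; ring.
by rewrite /sseq /=; ring.
Qed.

Lemma sseq_sub (k : int) : sseq (k + 1) - sseq k = tseq (k + 1).
Proof.
apply: (@linrec_sol_unique R x (fun k => sseq (k + 1) - sseq k)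
  (fun k => tseq (k + 1))) => [q|q||].
- rewrite (_ : q + 2 + 1 = q + 1 + 2); last ring.
  rewrite !sseq_sol (_ : q + 1 + 1 = q + 2) ?sseq_sol; ring.
- rewrite (_ : q + 2 + 1 = q + 1 + 2); last ring.
  by rewrite tseq_sol.
- by rewrite /sseq /tseq /=; ring.
by rewrite /sseq /tseq /=; ring.
Qed.

(** By [sseq_sub] the left side is the second difference s_(k+1) - 2 s_k + s_(k-1). *)
Lemma tseq_sub (k : int) : tseq (k + 1) - tseq k = (x - 2) * sseq k.
Proof.
have := sseq_sub (k - 1); rewrite subrK => <-; rewrite -sseq_sub.
have := sseq_sol (k - 1); rewrite subrK (_ : k - 1 + 2 = k + 1); last ring.
by move=> ->; ring.
Qed.

Lemma tseq_double (k : int) : tseq (2 * k + 1) = 2 + (x - 2) * sseq k ^+ 2.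
Proof.
(* One factor s_k is absorbed by [tseq_sub]; the two products then expand to s_(2k+1) + s_(-1) -
   s_(2k) - s_0. *)
rewrite expr2 mulrA -tseq_sub mulrBl !linrec_sol_shift; try exact: sseq_sol.
rewrite subrr (_ : k - (k + 1) = - 0 - 1) ?sseqN; last ring.
rewrite -sseq_sub (_ : k + (k + 1) = 2 * k + 1); last ring.
rewrite (_ : k + k = 2 * k); last ring.
by rewrite [sseq 0]/sseq /=; ring.
Qed.

End Sequences.

Lemma tseq_comp (R : comPzRingType) (x : R) (k p : int) :
  tseq (tseq x p) k = tseq x (k * p).
Proof.
apply: (@linrec_sol_unique R (tseq x p) _ (fun k => tseq x (k * p))) => [|q||].
- exact: tseq_sol.
- have := linrec_sol_step p 0 (@tseq_sol R x) q; by rewrite !add0r.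
- by rewrite mul0r.
by rewrite mul1r.
Qed.

Lemma sseq_comp (R : comPzRingType) (x : R) (k m : int) :
  sseq (tseq x (2 * m + 1)) k * sseq x m = sseq x (m + k * (2 * m + 1)).
Proof.
set p := 2 * m + 1.
apply: (@linrec_sol_unique R (tseq x p) (fun k => sseq (tseq x p) k * sseq x m)
  (fun k => sseq x (m + k * p))) => [q|||].
- rewrite sseq_sol; ring.
- exact/linrec_sol_step/sseq_sol.
- by rewrite /= mul0r addr0 /sseq /= mul1r.
(* At index 1, (T_p + 1) s_m = s_(m+p) + s_(m-p) + s_m, and the last two terms cancel because m - p
   = -m - 1. *)
rewrite [sseq _ 1]/sseq /= mulrDl linrec_sol_shift; last exact: sseq_sol.
rewrite (_ : m - p = - m - 1) ?sseqN; last by rewrite /p; ring.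
by rewrite !mul1r subrK.
Qed.

(** At parameter 2 the solutions are arithmetic progressions. This is the source of the factor [p]
    in the congruence: P_m(0) = s_m(2). *)
Lemma sseq2 (R : comPzRingType) (k : int) : sseq (2 : R) k = (2 * k + 1)%:~R.
Proof.
apply: (@linrec_sol_unique R 2 _ (fun k => (2 * k + 1)%:~R)) => [|q||] //.
- exact: sseq_sol.
- by ring.
by rewrite /sseq /=; ring.
Qed.

Lemma horner_spoly (k x : int) : (spoly k).[x] = sseq x k.
Proof. by rewrite /spoly horner_linrecz !hornerE. Qed.

Lemma horner_chebT (k x : int) : (chebT k).[x] = tseq x k.
Proof. by rewrite /chebT horner_linrecz !hornerE. Qed.

Lemma dvdz_horner_sub (q : {poly int}) (a b : int) :
  (a - b %| q.[a] - q.[b])%Z.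
Proof.
have /factor_theorem [r er] : root (q - q.[b]%:P) b.
  by rewrite /root !hornerE subrr.
have := congr1 (horner^~ a) er; rewrite !hornerE => ->.
exact: dvdz_mull.
Qed.

Theorem theorem42 (p j i k : int)
  (hp : ~~ (2 %| p)%Z)
  (hk : k = ((p - 1) %/ 2)%Z + i * p) :
  (spoly k).[(chebT p).[j]] =
    (spoly i).[(chebT p).[j]] *
      (Ppoly ((p - 1) %/ 2)%Z).[(2 - j) * (spoly k).[j] ^+ 2]
  /\ ((spoly k).[(chebT p).[j]] = p * (spoly i).[(chebT p).[j]]
        %[mod (j - 2) * (spoly k).[j] ^+ 2])%Z.
Proof.
set m := ((p - 1) %/ 2)%Z in hk *.
have ep : p = 2 * m + 1 by rewrite /m; lia.
(* With z the argument of [Ppoly], [y] is 2 - z, so P_m(z) = s_m(y); moreover [y - 2] is the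
   modulus. *)
pose y := 2 + (j - 2) * (spoly k).[j] ^+ 2.
have ey : y = tseq (tseq j p) (2 * i + 1).
  rewrite tseq_comp /y horner_spoly -tseq_double hk ep.
  by congr (tseq _ _); ring.
have main : (spoly k).[(chebT p).[j]] =
    (spoly i).[(chebT p).[j]] * (spoly m).[y].
  (* Here [sseq_comp] is applied with [i] as the half-index: i + m(2i + 1) = m + i(2m + 1) = k. *)
  rewrite horner_chebT !horner_spoly ey mulrC sseq_comp hk ep.
  by congr (sseq _ _); ring.
split.
  by rewrite main horner_Ppoly; congr (_ * _.[_]); rewrite /y; ring.
(* As s_m(2) = p, the two sides differ by s_i(T_p(j)) (s_m(y) - s_m(2)). *)
apply/eqP; rewrite eqz_mod_dvd main mulrC -mulrBl.
have := dvdz_horner_sub (spoly m) y 2.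
rewrite (_ : y - 2 = (j - 2) * (spoly k).[j] ^+ 2); last by rewrite /y; ring.
by rewrite horner_spoly [X in _ - X]horner_spoly sseq2 intz -ep horner_spoly;
  apply: dvdz_mulr.
Qed.
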